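(* The $S_3$-action $\mathsf{act}$ on $\mathfrak{so}_8$ (defined in the context) gives an embedding of groups $S_3\hookrightarrow\operatorname{Aut}(\mathfrak{so}_8)$ into the group of Lie algebra automorphisms of $\mathfrak{so}_8$, and this action coincides with the triality action.
   Context: Setup. Equip $\mathbb{C}^8$ (standard basis $e_1,\dots,e_8$) with the symmetric bilinear form $(e_i,e_j)=\delta_{i,9-j}$, let $\mathfrak{so}_8$ be its orthogonal Lie algebra, and identify $\bigwedge^2\mathbb{C}^8=\mathfrak{so}_8$ by letting $v_1\wedge v_2$ correspond to the endomorphism $u\mapsto(v_1,u)v_2-(v_2,u)v_1$. Label the simple roots of $D_4$ as $\alpha_1=\epsilon_1-\epsilon_2$, $\alpha_2=\epsilon_2-\epsilon_3$, $\alpha_3=\epsilon_3-\epsilon_4$, $\alpha_4=\epsilon_3+\epsilon_4$ ($\alpha_2$ is the central node). Use the following basis of $\mathfrak{so}_8$: $X_{\alpha_1}=e_1\wedge e_7$, $X_{\alpha_2}=e_2\wedge e_6$, $X_{\alpha_3}=e_3\wedge e_5$, $X_{\alpha_4}=e_3\wedge e_4$, $X_{\alpha_1+\alpha_2}=e_1\wedge e_6$, $X_{\alpha_2+\alpha_3}=e_2\wedge e_5$, $X_{\alpha_2+\alpha_4}=e_2\wedge e_4$, $X_{\alpha_2+\alpha_3+\alpha_4}=e_2\wedge e_3$, $X_{\alpha_1+\alpha_2+\alpha_4}=e_1\wedge e_4$, $X_{\alpha_1+\alpha_2+\alpha_3}=e_1\wedge e_5$, $X_{\alpha_1+\alpha_2+\alpha_3+\alpha_4}=e_1\wedge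 e_3$, $X_{\alpha_1+2\alpha_2+\alpha_3+\alpha_4}=e_1\wedge e_2$; $Y_{-\alpha_1}=e_2\wedge e_8$, $Y_{-\alpha_2}=e_3\wedge e_7$, $Y_{-\alpha_3}=e_4\wedge e_6$, $Y_{-\alpha_4}=e_5\wedge e_6$, $Y_{-\alpha_1-\alpha_2}=e_3\wedge e_8$, $Y_{-\alpha_2-\alpha_3}=e_4\wedge e_7$, $Y_{-\alpha_2-\alpha_4}=e_5\wedge e_7$, $Y_{-\alpha_2-\alpha_3-\alpha_4}=e_6\wedge e_7$, $Y_{-\alpha_1-\alpha_2-\alpha_4}=e_5\wedge e_8$, $Y_{-\alpha_1-\alpha_2-\alpha_3}=e_4\wedge e_8$, $Y_{-\alpha_1-\alpha_2-\alpha_3-\alpha_4}=e_6\wedge e_8$, $Y_{-\alpha_1-2\alpha_2-\alpha_3-\alpha_4}=e_7\wedge e_8$; and, with $H_i=e_i\wedge e_{9-i}$: $H_{\alpha_1}=H_1-H_2$, $H_{\alpha_2}=H_2-H_3$, $H_{\alpha_3}=H_3-H_4$, $H_{\alpha_4}=H_3+H_4$. Triality action. The triality action is the action of $S_3$, viewed as the group of automorphisms of the Dynkin diagram $D_4$ fixing $\alpha_2$ and permuting $\alpha_1,\alpha_3,\alpha_4$, by those Lie algebra automorphisms of $\mathfrak{so}_8$ which permute the elements $X_{\alpha_i},Y_{-\alpha_i},H_{\alpha_i}$ ($i=1,2,3,4$) accordingly. The indices $1,2,3$ permuted by $S_3$ correspond to $\alpha_1,\alpha_3,\alpha_4$ respectively.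 The action $\mathsf{act}$. Decompose $\mathfrak{so}_8=L\oplus\varphi_2(\mathfrak{h})\oplus V_1\oplus V_2\oplus V_3\oplus V_1^*\oplus V_2^*\oplus V_3^*$, where: $L\cong\mathfrak{sl}_3$ is spanned by $X_\gamma,Y_{-\gamma}$ for $\gamma\in\{\alpha_2,\ \alpha_1+\alpha_2+\alpha_3+\alpha_4,\ \alpha_1+2\alpha_2+\alpha_3+\alpha_4\}$ together with $H_{\alpha_2}$ and $H_{\alpha_1}+H_{\alpha_2}+H_{\alpha_3}+H_{\alpha_4}$; $\mathfrak{h}=\{(c_1,c_2,c_3)\in\mathbb{C}^3:c_1+c_2+c_3=0\}$ and $\varphi_2(c_1,c_2,c_3)=c_1H_{\alpha_1}+c_2H_{\alpha_3}+c_3H_{\alpha_4}$; and the remaining spaces have the following ordered bases, by which the $V_i$ are identified with each other ($\cong\mathbb{C}^3$ as $\mathfrak{sl}_3$-representations) and the $V_i^*$ with each other ($\cong(\mathbb{C}^3)^*$): $V_1=\langle -X_{\alpha_1+\alpha_2},X_{\alpha_1},Y_{-\alpha_2-\alpha_3-\alpha_4}\rangle$, $V_2=\langle X_{\alpha_2+\alpha_3},X_{\alpha_3},Y_{-\alpha_1-\alpha_2-\alpha_4}\rangle$, $V_3=\langle X_{\alpha_2+\alpha_4},X_{\alpha_4},Y_{-\alpha_1-\alpha_2-\alpha_3}\rangle$, $V_1^*=\langle X_{\alpha_2+\alpha_3+\alpha_4},Y_{-\alpha_1},-Y_{-\alpha_1-\alpha_2}\rangle$, $V_2^*=\langle X_{\alpha_1+\alpha_2+\alpha_4},Y_{-\alpha_3},Y_{-\alpha_2-\alpha_3}\rangle$,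 $V_3^*=\langle X_{\alpha_1+\alpha_2+\alpha_3},Y_{-\alpha_4},Y_{-\alpha_2-\alpha_4}\rangle$. For $\sigma\in S_3$, $\mathsf{act}(\sigma)$ is the linear map that fixes $L$ pointwise, acts on $\varphi_2(\mathfrak{h})$ through the Weyl group action of $S_3$ on $\mathfrak{h}$ (permuting coordinates: $(\sigma c)_{\sigma(i)}=c_i$), and permutes subscripts, i.e. sends $V_i\to V_{\sigma(i)}$ and $V_i^*\to V_{\sigma(i)}^*$ by the linear isomorphisms taking, for each $k=1,2,3$, the $k$-th vector of the listed ordered basis of $V_i$ (resp. $V_i^*$) to the $k$-th vector of the listed ordered basis of $V_{\sigma(i)}$ (resp. $V_{\sigma(i)}^*$). *)

(* Defs.v *)
From HB Require Import structures.
From mathcomp Require Import all_boot all_fingroup all_algebra.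
Set Implicit Arguments.
Unset Strict Implicit.
Unset Printing Implicit Defensive.
Import GRing.Theory Num.Theory.
Local Open Scope ring_scope.

Section So8.
Variable F : numFieldType.

(* J is the Gram matrix of (e_i, e_j) = delta_(i, 9 - j). *)
Definition J : 'M[F]_8 := \matrix_(i, j) (i == rev_ord j)%:R.

Definition form (u v : 'cV[F]_8) : F := (u^T *m J *m v) 0 0.

Definition skew_defect (A : 'M[F]_8) : 'M[F]_8 := A^T *m J + J *m A.

Fact skew_defect_is_linear : linear skew_defect.
Proof.
move=> a A B; rewrite /skew_defect linearP mulmxDl mulmxDr -scalemxAl -scalemxAr.
by rewrite scalerDr addrACA.
Qed.
HB.instance Definition _ :=
  GRing.isLinear.Build F 'M[F]_8 'M[F]_8 *:%R skew_defect skew_defect_is_linear.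

Definition so8_space : {vspace 'M[F]_8} := lker (linfun skew_defect).

Lemma mem_so8 A : (A \in so8_space) = (A^T *m J + J *m A == 0).
Proof. by rewrite memv_ker lfunE. Qed.

Lemma formE u v : u^T *m J *m v = (form u v)%:M.
Proof. exact: mx11_scalar. Qed.

Lemma so8P A :
  reflect (forall u v, form (A *m u) v + form u (A *m v) = 0) (A \in so8_space).
Proof.
have E u v : form (A *m u) v + form u (A *m v)
           = (u^T *m (A^T *m J + J *m A) *m v) 0 0.
  by rewrite /form trmx_mul mulmxDr mulmxDl !mulmxA [RHS]mxE.
rewrite mem_so8; apply: (iffP eqP) => [A0 u v | A0].
  by rewrite E A0 mulmx0 mul0mx mxE.
apply/matrixP=> i j; rewrite [RHS]mxE -(A0 (delta_mx i 0) (delta_mx j 0)) E.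
by rewrite trmx_delta -rowE -colE !mxE.
Qed.

Definition so8 := subvs_of so8_space.

Fact bracket_so8 (x y : so8) :
  vsval x *m vsval y - vsval y *m vsval x \in so8_space.
Proof.
have /so8P hx := subvsP x; have /so8P hy := subvsP y; apply/so8P=> u v.
have fB a b c : form (a - b) c = form a c - form b c.
  by rewrite /form linearB /= !mulmxBl !mxE.
have fBr a b c : form a (b - c) = form a b - form a c.
  by rewrite /form mulmxBr !mxE.
have N (z : so8) : forall a b, form (vsval z *m a) b = - form a (vsval z *m b).
  by have /so8P hz := subvsP z; move=> a b; apply/eqP; rewrite -addr_eq0 hz.
by rewrite !mulmxBl -!mulmxA fB fBr !N !opprK addrC subrKA subrr.
Qed.

Definition bracket (x y : so8) : so8 := Subvs (bracket_so8 x y).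

Definition wedge_mx (u v : 'cV[F]_8) : 'M[F]_8 :=
  v *m u^T *m J - u *m v^T *m J.

Lemma wedge_mxE u v w :
  wedge_mx u v *m w = form u w *: v - form v w *: u.
Proof.
rewrite /wedge_mx mulmxBl -!mulmxA !(mulmxA _ J) !formE.
by rewrite !mul_mx_scalar.
Qed.

Fact wedge_so8 u v : wedge_mx u v \in so8_space.
Proof.
have fC a b : form a b = form b a.
  have JT : J^T = J.
    apply/matrixP=> i j; rewrite !mxE; congr (_ %:R).
    by rewrite -(inj_eq rev_ord_inj) rev_ordK eq_sym.
  by rewrite /form -[in RHS]JT -[a in RHS]trmxK -!trmx_mul mulmxA [RHS]mxE.
apply/so8P=> a b; rewrite fC !wedge_mxE.
have fB c d k l e : form e (k *: c - l *: d) = k * form e c - l * form e d.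
  by rewrite /form mulmxBr -!scalemxAr !mxE.
rewrite !fB ![form b _]fC ![form a _]fC.
by rewrite [form u b * _]mulrC [form v b * _]mulrC addrC subrKA subrr.
Qed.

Definition wedge (u v : 'cV[F]_8) : so8 := Subvs (wedge_so8 u v).

(* e_1, ..., e_8: the argument runs from 1 to 8. *)
Definition e (i : nat) : 'cV[F]_8 := delta_mx (inord i.-1) 0.

Definition ew (i j : nat) : so8 := wedge (e i) (e j).

(* Root vectors: the digits following "a" list the simple roots to be summed,
   e.g. Xa12234 is X_(alpha_1 + 2 alpha_2 + alpha_3 + alpha_4) and Ya23 is
   Y_(- alpha_2 - alpha_3). *)
Definition Xa1 : so8 := ew 1 7.
Definition Xa2 : so8 := ew 2 6.
Definition Xa3 : so8 := ew 3 5.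
Definition Xa4 : so8 := ew 3 4.
Definition Xa12 : so8 := ew 1 6.
Definition Xa23 : so8 := ew 2 5.
Definition Xa24 : so8 := ew 2 4.
Definition Xa234 : so8 := ew 2 3.
Definition Xa124 : so8 := ew 1 4.
Definition Xa123 : so8 := ew 1 5.
Definition Xa1234 : so8 := ew 1 3.
Definition Xa12234 : so8 := ew 1 2.
Definition Ya1 : so8 := ew 2 8.
Definition Ya2 : so8 := ew 3 7.
Definition Ya3 : so8 := ew 4 6.
Definition Ya4 : so8 := ew 5 6.
Definition Ya12 : so8 := ew 3 8.
Definition Ya23 : so8 := ew 4 7.
Definition Ya24 : so8 := ew 5 7.
Definition Ya234 : so8 := ew 6 7.
Definition Ya124 : so8 := ew 5 8.
Definition Ya123 : so8 := ew 4 8.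
Definition Ya1234 : so8 := ew 6 8.
Definition Ya12234 : so8 := ew 7 8.
Definition H (i : nat) := ew i (9 - i)%N.
Definition Ha1 : so8 := H 1 - H 2.
Definition Ha2 : so8 := H 2 - H 3.
Definition Ha3 : so8 := H 3 - H 4.
Definition Ha4 : so8 := H 3 + H 4.

(* The outer nodes alpha_1, alpha_3, alpha_4 of the Dynkin diagram are indexed
   by 0, 1, 2 : 'I_3. *)
Definition Xout (i : 'I_3) : so8 := tnth [tuple Xa1; Xa3; Xa4] i.
Definition Yout (i : 'I_3) : so8 := tnth [tuple Ya1; Ya3; Ya4] i.
Definition Hout (i : 'I_3) : so8 := tnth [tuple Ha1; Ha3; Ha4] i.

Definition lie_aut (f : 'End(so8)) : Prop :=
  bijective f /\ forall x y, f (bracket x y) = bracket (f x) (f y).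

(* An injective group morphism from S_3 to the group of Lie automorphisms.
   The product of permutations is diagrammatic, (s * t) i = t (s i), so that
   the composite "t after s" is s * t. *)
Definition S3_embedding_in_Aut (rho : 'S_3 -> 'End(so8)) : Prop :=
  [/\ forall s, lie_aut (rho s),
      rho 1%g = \1%VF,
      forall s t, rho (s * t)%g = (rho t \o rho s)%VF
    & injective rho].

Definition permutes_generators (s : 'S_3) (f : 'End(so8)) : Prop :=
  [/\ f Xa2 = Xa2, f Ya2 = Ya2, f Ha2 = Ha2
    & forall i, [/\ f (Xout i) = Xout (s i), f (Yout i) = Yout (s i)
                  & f (Hout i) = Hout (s i)]].

(* Multiplicativity need not be required: a Lie automorphism is determined by
   its values on the generators, so at most one tau satisfies this. *)
Definition triality_action (tau : 'S_3 -> 'End(so8)) : Prop :=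
  forall s, lie_aut (tau s) /\ permutes_generators s (tau s).

Definition L_basis : seq so8 :=
  [:: Xa2; Ya2; Xa1234; Ya1234; Xa12234; Ya12234; Ha2; Ha1 + Ha2 + Ha3 + Ha4].

Definition phi2 (c : 'rV[F]_3) : so8 := \sum_i c 0 i *: Hout i.

Definition weyl (s : 'S_3) (c : 'rV[F]_3) : 'rV[F]_3 :=
  \row_i c 0 (s^-1%g i).

Lemma weylE s c i : weyl s c 0 (s i) = c 0 i.
Proof. by rewrite mxE permK. Qed.

(* (1, -1, 0) and (0, 1, -1) span the plane c_1 + c_2 + c_3 = 0. *)
Definition h_basis : seq 'rV[F]_3 :=
  [:: \row_i tnth [tuple 1; -1; 0] i; \row_i tnth [tuple 0; 1; -1] i].

(* V i k and Vd i k are the k-th vectors of the ordered bases of V_i and of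
   its dual V_i^*. *)
Definition V (i k : 'I_3) : so8 :=
  tnth (tnth [tuple [tuple - Xa12; Xa1; Ya234];
                    [tuple Xa23; Xa3; Ya124];
                    [tuple Xa24; Xa4; Ya123]] i) k.
Definition Vd (i k : 'I_3) : so8 :=
  tnth (tnth [tuple [tuple Xa234; Ya1; - Ya12];
                    [tuple Xa124; Ya3; Ya23];
                    [tuple Xa123; Ya4; Ya24]] i) k.

(* The images under s of the vectors of an adapted basis, which is itself
   obtained for s = 1. *)
Definition adapted (s : 'S_3) : seq so8 :=
  L_basis ++ [seq phi2 (weyl s c) | c <- h_basis]
  ++ [seq V (s i) k | i <- enum 'I_3, k <- enum 'I_3]
  ++ [seq Vd (s i) k | i <- enum 'I_3, k <- enum 'I_3].

Definition so8_act_fun (s : 'S_3) (x : so8) : so8 :=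
  \sum_j coord (in_tuple (adapted 1%g)) j x *: (adapted s)`_j.

Fact so8_act_fun_is_linear s : linear (so8_act_fun s).
Proof.
move=> a x y; rewrite /so8_act_fun scaler_sumr -big_split /=.
by apply: eq_bigr => j _; rewrite linearP scalerDl scalerA.
Qed.
HB.instance Definition _ s :=
  GRing.isLinear.Build F so8 so8 *:%R (so8_act_fun s) (so8_act_fun_is_linear s).

Definition so8_act (s : 'S_3) : 'End(so8) := linfun (so8_act_fun s).

End So8.

Section ActSpec.
Variable F : numFieldType.

Fact wedgeC (u v : 'cV[F]_8) : wedge u v = - wedge v u.
Proof. by apply: val_inj; rewrite /= /wedge_mx opprB. Qed.

Lemma ew_entry (i j a b : 'I_8) :
  vsval (ew F i.+1 j.+1) a b =
    ((a == j) && (b == rev_ord i))%:R - ((a == i) && (b == rev_ord j))%:R.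
Proof.
have eE (k : 'I_8) : e F k.+1 = delta_mx k 0 by rewrite /e /= inord_val.
have D (k l : 'I_8) :
  (e F k.+1 *m (e F l.+1)^T *m J F) a b = ((a == k) && (b == rev_ord l))%:R.
  rewrite !eE -mulmxA trmx_delta -rowE mxE big_ord_recl big_ord0 addr0 !mxE.
  by rewrite andbT -natrM mulnb -[b == _](inj_eq rev_ord_inj) rev_ordK [l == _]eq_sym.
by rewrite /= /wedge_mx [LHS]mxE [X in _ + X]mxE !D.
Qed.

Fact ord3E : enum 'I_3 = [:: ord0; lift ord0 ord0; ord_max].
Proof.
by apply: (inj_map val_inj); rewrite val_enum_ord.
Qed.

Fact size_adapted s : size (adapted F s) = 28%N.
Proof. by rewrite /adapted ord3E. Qed.

Lemma span_adapted : (fullv <= <<adapted F 1%g>>)%VS.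
Proof.
set B := adapted _ _.
have inL x : x \in L_basis F -> x \in <<B>>%VS.
  by move=> xL; apply: memv_span; rewrite mem_cat xL.
have inV i k : V F i k \in <<B>>%VS.
  apply: memv_span; rewrite !mem_cat; apply/or4P; apply: Or43.
  by apply/allpairsP; exists (i, k); rewrite !mem_enum perm1.
have inVd i k : Vd F i k \in <<B>>%VS.
  apply: memv_span; rewrite !mem_cat; apply/or4P; apply: Or44.
  by apply/allpairsP; exists (i, k); rewrite !mem_enum perm1.
have inh c : c \in h_basis F -> phi2 c \in <<B>>%VS.
  move=> ch; apply: memv_span; rewrite !mem_cat; apply/or4P; apply: Or42.
  apply/mapP; exists c => //; congr phi2; apply/rowP=> i.
  by rewrite mxE invg1 perm1.
pose i0 : 'I_3 := ord0; pose i1 : 'I_3 := lift ord0 ord0; pose i2 : 'I_3 := ord_max.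
have inH : [/\ H F 1 \in <<B>>, H F 2 \in <<B>>, H F 3 \in <<B>> & H F 4 \in <<B>>]%VS.
  have h2 : Ha2 F \in <<B>>%VS by apply: inL; rewrite !inE eqxx ?orbT.
  have hs : Ha1 F + Ha2 F + Ha3 F + Ha4 F \in <<B>>%VS.
    by apply: inL; rewrite !inE eqxx ?orbT.
  have h13 : H F 1 + H F 3 \in <<B>>%VS.
    suff -> : H F 1 + H F 3 = Ha1 F + Ha2 F + Ha3 F + Ha4 F by [].
    by rewrite /Ha1 /Ha2 /Ha3 /Ha4 !addrA !subrK [RHS]addrAC subrK.
  have c1 : Ha1 F - Ha3 F \in <<B>>%VS.
    have := inh _ (mem_head _ _); rewrite /phi2 !big_ord_recl big_ord0 !mxE /=.
    by rewrite scale1r scaleN1r scale0r !addr0.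
  have c2 : Ha3 F - Ha4 F \in <<B>>%VS.
    have := inh (\row_i tnth [tuple 0; 1; -1] i).
    rewrite !inE eqxx orbT /phi2 !big_ord_recl big_ord0 !mxE /=.
    by rewrite scale1r scaleN1r scale0r add0r !addr0; apply.
  have half x : x *+ 2 \in <<B>>%VS -> x \in <<B>>%VS.
    rewrite -scaler_nat => hx; have := memvZ (2%:R^-1) hx.
    by rewrite scalerA mulVf ?pnatr_eq0 // scale1r.
  have third x : x *+ 3 \in <<B>>%VS -> x \in <<B>>%VS.
    rewrite -scaler_nat => hx; have := memvZ (3%:R^-1) hx.
    by rewrite scalerA mulVf ?pnatr_eq0 // scale1r.
  have h4 : H F 4 \in <<B>>%VS.
    apply: half; rewrite -memvN; suff <- : Ha3 F - Ha4 F = - (H F 4 *+ 2) by [].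
    by rewrite /Ha3 /Ha4 opprD addrACA subrr add0r mulr2n opprD.
  have h3 : H F 3 \in <<B>>%VS.
    have := memvB c1 h4; rewrite /Ha1 /Ha3 opprB addrCA [H F 4 + _]addrC addrK.
    move=> e1; have := memvD e1 h2; rewrite /Ha2 [X in X + _]addrAC addrA subrK.
    move=> e2; have := memvB h13 e2; rewrite !opprB !addrA.
    rewrite addrAC [X in X + _]addrAC. rewrite [X in X + _ + _]addrAC subrr add0r.
    by move=> e3; apply: third; rewrite mulrSr mulr2n.
  have h2' : H F 2 \in <<B>>%VS by rewrite -[H F 2](subrK (H F 3)) memvD.
  have h1 : H F 1 \in <<B>>%VS by rewrite -[H F 1](addrK (H F 3)) memvB.
  by [].
have [H1 H2 H3 H4] := inH.
have L k : (k < 8)%N -> (L_basis F)`_k \in <<B>>%VS.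
  by move=> k8; apply/inL/mem_nth.
have inX i j : (0 < i < j)%N -> (j <= 8)%N -> ew F i j \in <<B>>%VS.
  have := (inV i0 i0, inV i0 i1, inV i0 i2, inV i1 i0, inV i1 i1, inV i1 i2,
    inV i2 i0, inV i2 i1, inV i2 i2).
  have := (inVd i0 i0, inVd i0 i1, inVd i0 i2, inVd i1 i0, inVd i1 i1,
    inVd i1 i2, inVd i2 i0, inVd i2 i1, inVd i2 i2).
  have := (L 0 isT, L 1 isT, L 2 isT, L 3 isT, L 4 isT, L 5 isT)%N.
  rewrite /V /Vd /= !memvN => a b c.
  case: i => [|[|[|[|[|[|[|[|[|i]]]]]]]]] //;
  case: j => [|[|[|[|[|[|[|[|[|j]]]]]]]]] // _ _; by rewrite ?a ?b ?c.
have inW i j : (0 < i <= 8)%N -> (0 < j <= 8)%N -> ew F i j \in <<B>>%VS.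
  case/andP=> i0' i8 /andP[j0 j8]; have [ij|ji|->] := ltngtP i j.
  - by rewrite inX ?i0' ?ij.
  - by rewrite /ew wedgeC memvN inX ?j0 ?ji.
  by rewrite /ew (_ : wedge _ _ = 0) ?mem0v //; apply: val_inj; rewrite /= /wedge_mx subrr.
apply/subvP=> x _.
suff -> : x = 2%:R^-1 *: \sum_(i < 8) \sum_(j < 8)
              vsval x j (rev_ord i) *: ew F i.+1 j.+1.
  by apply/memvZ/memv_suml=> i _; apply/memv_suml=> j _; rewrite memvZ ?inW ?ltn_ord.
apply: val_inj; apply/matrixP=> a b.
have anti : vsval x a b = - vsval x (rev_ord b) (rev_ord a).
  have := subvsP x; rewrite mem_so8 => /eqP/matrixP/(_ (rev_ord a) b).
  rewrite !mxE (bigD1 (rev_ord b)) //= big1 => [|k kb]; last first.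
    by rewrite !mxE (negPf kb) mulr0.
  rewrite (bigD1 a) //= big1 => [|k ka]; last first.
    by rewrite !mxE (inj_eq rev_ord_inj) eq_sym (negPf ka) mul0r.
  rewrite !mxE !eqxx mulr1 mul1r !addr0 => /eqP.
  by rewrite addrC addr_eq0 => /eqP.
rewrite linearZ /= mxE.
transitivity (2^-1 * \sum_(i < 8) \sum_(j < 8) (vsval x j (rev_ord i) *
   (((a == j) && (b == rev_ord i))%:R - ((a == i) && (b == rev_ord j))%:R))); last first.
  congr (_ * _); rewrite linear_sum summxE; apply: eq_bigr => i _.
  rewrite linear_sum summxE; apply: eq_bigr => j _.
  by rewrite linearZ /= mxE ew_entry.
under eq_bigr do (under eq_bigr do rewrite mulrBr; rewrite sumrB).
have dd (G : 'I_8 -> 'I_8 -> F) p q :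
    \sum_i \sum_j G i j * ((i == p) && (j == q))%:R = G p q.
  rewrite (bigD1 p) //= [X in _ + X]big1 ?addr0 => [|i /negPf ip]; last first.
    by rewrite big1 // => j _; rewrite ip mulr0.
  rewrite (bigD1 q) //= big1 ?addr0 => [|j /negPf jq]; last first.
    by rewrite jq andbF mulr0.
  by rewrite !eqxx mulr1.
rewrite sumrB.
have -> : \sum_i \sum_j vsval x j (rev_ord i)
      * ((a == j) && (b == rev_ord i))%:R = vsval x a b.
  rewrite -[in RHS](rev_ordK b) -(dd (fun i j => vsval x j (rev_ord i))).
  apply: eq_bigr => i _; apply: eq_bigr => j _; congr (_ * _%:R).
  by rewrite -[b == _](inj_eq rev_ord_inj) rev_ordK andbC [a == _]eq_sym [_ == i]eq_sym.
have -> : \sum_i \sum_j vsval x j (rev_ord i)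
      * ((a == i) && (b == rev_ord j))%:R = - vsval x a b.
  rewrite anti opprK -(dd (fun i j => vsval x j (rev_ord i))).
  apply: eq_bigr => i _; apply: eq_bigr => j _; congr (_ * _%:R).
  by rewrite -[b == _](inj_eq rev_ord_inj) rev_ordK [a == _]eq_sym [_ == j]eq_sym.
by rewrite opprK -[vsval x a b in RHS]mul1r -mulrDl mulKf ?pnatr_eq0.
Qed.


Lemma dim_so8 : (28 <= \dim (fullv : {vspace so8 F}))%N.
Proof.
pose ps := [seq (i, j) | i <- iota 0 8, j <- iota i.+1 (7 - i)].
have ltps k : (k < 28)%N ->
    ((nth (0, 0) ps k).1 < (nth (0, 0) ps k).2 < 8)%N.
  move=> k28; have /allP : all (fun p : nat * nat => p.1 < p.2 < 8)%N ps by [].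
  by apply; apply: mem_nth.
pose fst8 k := (nth (0, 0)%N ps k).1; pose snd8 k := (nth (0, 0)%N ps k).2.
pose X := [tuple ew F (fst8 k).+1 (snd8 k).+1 | k < 28].
suff /eqP <- : \dim <<X>>%VS == 28%N by apply/dimvS/subvf.
suff : free X by rewrite /free size_tuple.
apply/freeP => k k0 m.
have /andP[lm m8] := ltps m (ltn_ord m).
have /andP[/= l8 _] : ((fst8 m < 8) && true)%N by rewrite (ltn_trans lm).
move: k0 => /(congr1 (fun x : so8 F => vsval x (Ordinal m8) (rev_ord (Ordinal l8)))).
rewrite linear_sum summxE [RHS]mxE (bigD1 m) //= big1 => [|q qm].
  rewrite addr0 (nth_map m) ?size_enum_ord // nth_ord_enum.
  rewrite mxE.
  rewrite (ew_entry (Ordinal l8) (Ordinal m8)) !eqxx /=.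
  rewrite (_ : Ordinal m8 == Ordinal l8 = false) ?subr0 ?mulr1 //.
  by apply/negP=> /eqP[] E; move: lm; rewrite E -/(fst8 m) ltnn.
have /andP[lq q8] := ltps q (ltn_ord q).
have /andP[/= p8 _] : ((fst8 q < 8) && true)%N by rewrite (ltn_trans lq).
rewrite (nth_map m) ?size_enum_ord // nth_ord_enum.
rewrite mxE (ew_entry (Ordinal p8) (Ordinal q8)) !(inj_eq rev_ord_inj).
rewrite -!(inj_eq val_inj) /=.
have [E|_] /= := eqVneq (snd8 m) (snd8 q); last first.
  have [E'|_] /= := eqVneq (snd8 m) (fst8 q); last by rewrite subrr mulr0.
  have [E|_] := eqVneq (fst8 m) (snd8 q); last by rewrite subrr mulr0.
  by move: lm lq; rewrite -/(fst8 m) -/(fst8 q) -/(snd8 m) -/(snd8 q) E E';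
     move=> /ltnW; rewrite leqNgt => /negbTE->.
have [E'|_] := eqVneq (fst8 m) (fst8 q).
  case/negP: qm; rewrite -(inj_eq val_inj) /=.
  rewrite -(nth_uniq (0, 0)%N (_ : q < size ps)%N (_ : m < size ps)%N
             (_ : uniq ps)) ?ltn_ord //.
  apply/eqP; rewrite [LHS]surjective_pairing [RHS]surjective_pairing.
  by congr (_, _); apply/esym; [apply: E' | apply: E].
have [E''|_] := eqVneq (snd8 m) (fst8 q); last by rewrite subrr mulr0.
by move: lq; rewrite -/(fst8 q) -/(snd8 q) -E'' E ltnn.
Qed.


Lemma adapted_basis : basis_of fullv (adapted F 1%g).
Proof.
by rewrite basisEdim span_adapted size_adapted dim_so8.
Qed.

Lemma so8_act_adapted s j : so8_act F s (adapted F 1%g)`_j = (adapted F s)`_j.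
Proof.
rewrite lfunE /= /so8_act_fun; set B := in_tuple _.
have [lej|jl] := leqP (size (adapted F 1%g)) j.
  rewrite !nth_default ?size_adapted -?(size_adapted 1) //.
  by apply: big1 => i _; rewrite linear0 scale0r.
have fB : free B by apply: (basis_free adapted_basis).
rewrite (bigD1 (Ordinal jl)) //= big1 => [|i ij].
  by rewrite (coord_free (Ordinal jl) (Ordinal jl) fB) eqxx scale1r addr0.
by rewrite (coord_free (Ordinal jl) i fB) eq_sym (negPf ij) scale0r.
Qed.

Lemma so8_act_L s x : x \in <<L_basis F>>%VS -> so8_act F s x = x.
Proof.
move=> /coord_span ->; rewrite linear_sum; apply: eq_bigr => j _.
rewrite linearZ /=; congr (_ *: _).
by have := so8_act_adapted s j; rewrite !nth_cat (ltn_ord j).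
Qed.

Fact ord3P (i : 'I_3) : [\/ i = ord0, i = lift ord0 ord0 | i = ord_max].
Proof.
have : i \in enum 'I_3 by rewrite mem_enum.
by rewrite ord3E !inE => /or3P[]/eqP->; [apply: Or31 | apply: Or32 | apply: Or33].
Qed.

Lemma so8_act_V s i k : so8_act F s (V F i k) = V F (s i) k.
Proof.
have := so8_act_adapted s (10 + (3 * i + k)); rewrite /adapted ord3E.
by case: (ord3P i) => ->; case: (ord3P k) => -> /=; rewrite perm1.
Qed.

Lemma so8_act_Vd s i k : so8_act F s (Vd F i k) = Vd F (s i) k.
Proof.
have := so8_act_adapted s (19 + (3 * i + k)); rewrite /adapted ord3E.
by case: (ord3P i) => ->; case: (ord3P k) => -> /=; rewrite perm1.
Qed.

Lemma so8_act_phi2 s (c : 'rV[F]_3) :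
  \sum_i c 0 i = 0 -> so8_act F s (phi2 c) = phi2 (weyl s c).
Proof.
pose d1 : 'rV[F]_3 := \row_i tnth [tuple 1; -1; 0] i.
pose d2 : 'rV[F]_3 := \row_i tnth [tuple 0; 1; -1] i.
have phiD a (u v : 'rV[F]_3) : phi2 (a *: u + v) = a *: phi2 u + phi2 v.
  rewrite /phi2 scaler_sumr -big_split; apply: eq_bigr => i _.
  by rewrite !mxE scalerDl scalerA.
have phi0 : phi2 (0 : 'rV[F]_3) = 0.
  by rewrite /phi2 big1 // => i _; rewrite mxE scale0r.
have weylD a u v : weyl s (a *: u + v) = a *: weyl s u + weyl s v :> 'rV[F]_3.
  by apply/rowP=> i; rewrite !mxE.
have weyl1 (u : 'rV[F]_3) : weyl 1%g u = u.
  by apply/rowP=> i; rewrite mxE invg1 perm1.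
have a1 : so8_act F s (phi2 d1) = phi2 (weyl s d1).
  by have := so8_act_adapted s 8; rewrite /= weyl1.
have a2 : so8_act F s (phi2 d2) = phi2 (weyl s d2).
  by have := so8_act_adapted s 9; rewrite /= weyl1.
rewrite !big_ord_recl big_ord0 addr0 => c0.
have -> : c = c 0 ord0 *: d1 + (- c 0 ord_max *: d2 + 0).
  apply/rowP=> i; rewrite !mxE; case: (ord3P i) => -> /=.
  - by rewrite mulr1 mulr0 !addr0.
  - rewrite mulrN1 mulr1 addr0; apply/eqP; rewrite -subr_eq0 opprD !opprK.
    rewrite addrC -addrA (_ : ord_max = lift ord0 (lift ord0 ord0)) ?addrA; last exact: val_inj.
    by rewrite -c0 -!addrA [X in _ + X]addrC.
  by rewrite mulr0 mulrN1 opprK add0r addr0.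
have w0 : weyl s (0 : 'rV[F]_3) = 0 by apply/rowP=> i; rewrite !mxE.
by rewrite !phiD !weylD !phiD 2!linearP /= a1 a2 w0 phi0 linear0.
Qed.

End ActSpec.

(* Main.v *)
(* The vectors X, Y, H_(alpha_2), H_(alpha_1), H_(alpha_3), H_(alpha_4) and
   those of the V_i and V_i^* form a Chevalley basis, which act(s) carries to the
   same basis with the subscripts i replaced by s(i).  Since the structure
   constants of the two bases coincide (a finite check over the integers, for the
   six s), act(s) is a Lie automorphism.  It permutes the generators by
   construction, and a Lie automorphism is determined by its values on the
   generators, as every root vector is, up to sign, an iterated bracket of
   simple ones. *)
Require Import Defs.
From HB Require Import structures.
From mathcomp Require Import all_boot all_fingroup all_algebra.
From mathcomp Require Import zify ring reals complex.
Local Open Scope ring_scope.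
Local Open Scope complex_scope.
Import GRing.Theory Num.Theory.

Section Triality.
Variable F : numFieldType.
Implicit Types x y z : so8 F.

(** * Bilinearity of the bracket and its value on bivectors *)

Lemma bracketC x y : bracket x y = - bracket y x.
Proof. by apply: val_inj; rewrite /= opprB. Qed.

Lemma bracket_linear x : linear (bracket x).
Proof.
move=> a y y'; apply: val_inj; rewrite /= mulmxDl mulmxDr -scalemxAl -scalemxAr.
by rewrite scalerBr opprD addrACA.
Qed.
HB.instance Definition _ x := GRing.isLinear.Build F (so8 F) (so8 F) *:%R
  (bracket x) (bracket_linear x).

Lemma bracket_suml I (r : seq I) (c : I -> F) (b : I -> so8 F) y :
  bracket (\sum_(i <- r) c i *: b i) y = \sum_(i <- r) c i *: bracket (b i) y.
Proof.
rewrite bracketC linear_sum -sumrN; apply: eq_bigr => i _.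
by rewrite linearZ -scalerN -bracketC.
Qed.

(** The algebra acts on bivectors by derivations: skewness, [J x = - x^T J], turns right
    multiplication by [x] into minus its action on the transposed factor. *)
Lemma bracket_wedge x (u v : 'cV[F]_8) :
  val (bracket x (wedge u v)) =
    wedge_mx (vsval x *m u) v + wedge_mx u (vsval x *m v).
Proof.
have JA : J F *m vsval x = - ((vsval x)^T *m J F).
  by apply/eqP; rewrite -addr_eq0 addrC -mem_so8 subvsP.
rewrite /= /wedge_mx !trmx_mul mulmxBr mulmxBl -!(mulmxA _ (J F)) JA !mulmxN.
rewrite !mulmxA opprB opprK [- _ + _]addrC addrACA.
by rewrite [X in X + _]addrC -addrACA.
Qed.

(** The difference has the shape in which [wedge_mxE] returns the value of a bivector on a
    vector. *)
Lemma wedge_mxBl a b (u u' v : 'cV[F]_8) :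
  wedge_mx (a *: u - b *: u') v = a *: wedge_mx u v - b *: wedge_mx u' v.
Proof.
rewrite /wedge_mx [(_ - _)^T]linearB /= ![(_ *: _)^T]linearZ /=.
rewrite mulmxBr !mulmxBl -!scalemxAr -!scalemxAl !scalerBr !opprB.
by rewrite addrACA [RHS]addrACA [- _ + _]addrC.
Qed.

Lemma wedge_mxBr a b (u v v' : 'cV[F]_8) :
  wedge_mx u (a *: v - b *: v') = a *: wedge_mx u v - b *: wedge_mx u v'.
Proof.
have wC (p q : 'cV[F]_8) : wedge_mx p q = - wedge_mx q p.
  by rewrite /wedge_mx opprB.
by rewrite wC wedge_mxBl opprB !(wC u) !scalerN opprK addrC.
Qed.

Lemma form_e i j : (0 < i <= 8)%N -> (0 < j <= 8)%N ->
  Defs.form (e F i) (e F j) = (i + j == 9)%:R.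
Proof.
case: i j => [|i] [|j] //= i8 j8.
rewrite /Defs.form /e /= -mulmxA trmx_delta -rowE -colE !mxE -val_eqE /=.
rewrite !inordK //; congr (nat_of_bool _)%:R.
by apply/eqP/eqP; lia.
Qed.

(** * Exact integer computation with bivectors *)

(* A computable model of the integral combinations of the e_i /\ e_j: a list of
   terms (c, (i, j)), standing for c (e_i /\ e_j). *)
Definition ew_term := (int * (nat * nat))%type.

Definition comb (l : seq ew_term) : so8 F :=
  \sum_(t <- l) t.1%:~R *: ew F t.2.1 t.2.2.

Definition wf_term (t : ew_term) :=
  [&& 0 < t.2.1, t.2.1 <= 8, 0 < t.2.2 & t.2.2 <= 8]%N.

(** This is the derivation rule of [bracket_wedge]: the first two terms come from acting on [e_k],
    the last two from acting on [e_l]. Two basis vectors pair to 1 exactly when their indices add up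
    to 9. *)
Definition term_bracket (t u : ew_term) : seq ew_term :=
  let: (a, (i, j)) := t in let: (b, (k, l)) := u in
  (if (i + k == 9)%N then [:: (a * b, (j, l))] else [::])
  ++ (if (j + k == 9)%N then [:: (- (a * b), (i, l))] else [::])
  ++ (if (i + l == 9)%N then [:: (a * b, (k, j))] else [::])
  ++ (if (j + l == 9)%N then [:: (- (a * b), (k, i))] else [::]).

Definition comb_bracket (l m : seq ew_term) : seq ew_term :=
  flatten [seq term_bracket t u | t <- l, u <- m].

Lemma comb_cat l m : comb (l ++ m) = comb l + comb m.
Proof. exact: big_cat. Qed.

Lemma comb_nil : comb [::] = 0.
Proof. exact: big_nil. Qed.

Lemma comb_if (b : bool) a p :
  comb (if b then [:: (a, p)] else [::]) = a%:~R *: (b%:R *: ew F p.1 p.2).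
Proof.
by case: b; rewrite ?comb_nil ?scale0r ?scaler0 // /comb big_seq1 scale1r.
Qed.

Lemma comb_term_bracket t u : wf_term t -> wf_term u ->
  comb (term_bracket t u) =
    (t.1 * u.1)%:~R *: bracket (ew F t.2.1 t.2.2) (ew F u.2.1 u.2.2).
Proof.
case: t u => [a [i j]] [b [k l]] /and4P/= [i0 i8 j0 j8] /and4P/= [k0 k8 l0 l8].
rewrite !comb_cat !comb_if /= !mulrNz !scaleNr -!scalerN -!scalerDr.
congr (_ *: _); apply: val_inj; rewrite bracket_wedge !wedge_mxE.
by rewrite !form_e ?i0 ?j0 ?k0 ?l0 //= wedge_mxBl wedge_mxBr -addrA !scalerN.
Qed.

Lemma comb_bracketE l m : all wf_term l -> all wf_term m ->
  comb (comb_bracket l m) = bracket (comb l) (comb m).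
Proof.
move=> /allP wl /allP wm; rewrite /comb_bracket /comb big_flatten /=.
rewrite big_allpairs_dep bracket_suml big_seq [RHS]big_seq.
apply: eq_bigr => t tl; rewrite linear_sum scaler_sumr big_seq [RHS]big_seq.
apply: eq_bigr => u um.
rewrite -/(comb _) comb_term_bracket ?(wl _ tl) ?(wm _ um) //= linearZ /=.
by rewrite intrM scalerA.
Qed.

Definition comb_scale (c : int) (l : seq ew_term) : seq ew_term :=
  [seq (c * t.1, t.2) | t <- l].

Lemma comb_scaleE c l : comb (comb_scale c l) = c%:~R *: comb l.
Proof.
rewrite /comb big_map scaler_sumr; apply: eq_bigr => t _.
by rewrite intrM scalerA.
Qed.

(* The coefficient of e_i /\ e_j, up to antisymmetry, which is also the matrix
   entry in row j and column 9 - i. *)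
Definition wcoef (l : seq ew_term) (i j : nat) : int :=
  foldr (fun t c => (if t.2 == (i, j) then t.1 else 0)
                    - (if t.2 == (j, i) then t.1 else 0) + c) 0 l.

Lemma comb_entry l (a b : 'I_8) : all wf_term l ->
  vsval (comb l) a b = (wcoef l (8 - b) a.+1)%:~R.
Proof.
elim: l => [|[c [i j]] l IHl]; first by rewrite comb_nil mxE.
case/andP=> /and4P[/= i0 i8 j0 j8] /IHl {}IHl.
rewrite -cat1s comb_cat [LHS]mxE {}IHl /= intrD; congr (_ + _).
rewrite /comb big_seq1 /=; case: i j i0 i8 j0 j8 => [|i] [|j] // _ i8 _ j8.
rewrite [LHS]mxE (ew_entry F (Ordinal i8) (Ordinal j8)) -!val_eqE /=.
rewrite intrB mulrBr.
have b8 := ltn_ord b; have a8 := ltn_ord a.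
have -> : ((a : nat) == j) && ((b : nat) == 8 - i.+1)%N =
    ((i.+1, j.+1) == (8 - b, a.+1)%N).
  by rewrite xpair_eqE; apply/idP/idP; lia.
have -> : ((a : nat) == i) && ((b : nat) == 8 - j.+1)%N =
    ((i.+1, j.+1) == (a.+1, 8 - b)%N).
  by rewrite xpair_eqE; apply/idP/idP; lia.
by congr (_ - _); case: ifP; rewrite ?mulr1 ?mulr0.
Qed.

(** Like terms are never collected in the lists, so vanishing is tested coefficient by
    coefficient. *)
Definition zero_check (l : seq ew_term) : bool :=
  all wf_term l
  && all (fun i => all (fun j => wcoef l i j == 0) (iota 1 8)) (iota 1 8).

Lemma comb_eq0 l : zero_check l -> comb l = 0.
Proof.
case/andP=> wl /allP l0; apply/val_inj/matrixP=> a b.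
rewrite comb_entry // [RHS]mxE.
have b8 := ltn_ord b.
have /l0/allP/(_ a.+1) : (8 - b)%N \in iota 1 8 by rewrite mem_iota; lia.
have -> : a.+1 \in iota 1 8 by rewrite mem_iota /= ltnS; exact: ltn_ord.
by move=> /(_ isT)/eqP->.
Qed.

(** * Formal Chevalley bases and their structure constants *)

Definition pos_ew (i j : nat) : seq ew_term := [:: (1, (i, j))].
Definition neg_ew (i j : nat) : seq ew_term := [:: (-1, (i, j))].

Definition formal_L : seq (seq ew_term) :=
  [:: pos_ew 2 6; pos_ew 3 7; pos_ew 1 3; pos_ew 6 8; pos_ew 1 2; pos_ew 7 8].

Definition formal_Ha2 : seq ew_term := pos_ew 2 7 ++ neg_ew 3 6.

Definition formal_Hout : seq (seq ew_term) :=
  [:: pos_ew 1 8 ++ neg_ew 2 7; pos_ew 3 6 ++ neg_ew 4 5;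
      pos_ew 3 6 ++ pos_ew 4 5].

Definition formal_V : seq (seq (seq ew_term)) :=
  [:: [:: neg_ew 1 6; pos_ew 1 7; pos_ew 6 7];
      [:: pos_ew 2 5; pos_ew 3 5; pos_ew 5 8];
      [:: pos_ew 2 4; pos_ew 3 4; pos_ew 4 8]].

Definition formal_Vd : seq (seq (seq ew_term)) :=
  [:: [:: pos_ew 2 3; pos_ew 2 8; neg_ew 3 8];
      [:: pos_ew 1 4; pos_ew 4 6; pos_ew 4 7];
      [:: pos_ew 1 5; pos_ew 5 6; pos_ew 5 7]].

(* The permutation s is given by the list t = [s 0; s 1; s 2]. *)
Definition formal_chevalley (t : seq nat) : seq (seq ew_term) :=
  formal_L ++ formal_Ha2 :: [seq nth [::] formal_Hout i | i <- t]
  ++ flatten [seq nth [::] formal_V i | i <- t]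
  ++ flatten [seq nth [::] formal_Vd i | i <- t].

(** Differs from [adapted s] only in the Cartan part: the three outer coroots replace the sum in [L]
    and the two vectors of [phi2], which makes the structure constants integral. *)
Definition chevalley (s : 'S_3) : seq (so8 F) :=
  [:: Xa2 F; Ya2 F; Xa1234 F; Ya1234 F; Xa12234 F; Ya12234 F; Ha2 F]
  ++ [seq Hout F (s i) | i <- enum 'I_3]
  ++ [seq V F (s i) k | i <- enum 'I_3, k <- enum 'I_3]
  ++ [seq Vd F (s i) k | i <- enum 'I_3, k <- enum 'I_3].

(* Twice the coordinates of comb l in the basis chevalley 1; the factor 2 clears
   the denominators of
   sum_i h_i H_i = h_1 H_(alpha_1) + (h_1 + h_2) H_(alpha_2)
     + (h_1 + h_2 + h_3 - h_4) / 2 H_(alpha_3)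
     + (h_1 + h_2 + h_3 + h_4) / 2 H_(alpha_4). *)
Definition coords2 (l : seq ew_term) : seq int :=
  let root m := if m is (c, (i, j)) :: _ then 2 * (c * wcoef l i j) else 0 in
  let h (i : nat) := wcoef l i (9 - i)%N in
  map root formal_L ++ [:: 2 * (h 1 + h 2); 2 * h 1; h 1 + h 2 + h 3 - h 4;
                           h 1 + h 2 + h 3 + h 4]
  ++ map root (flatten formal_V) ++ map root (flatten formal_Vd).

Definition structure_constants2 (i j : nat) : seq int :=
  let b := formal_chevalley [:: 0; 1; 2]%N in
  coords2 (comb_bracket (nth [::] b i) (nth [::] b j)).

(** The constants are those of the unpermuted basis whatever [b] is, so a zero defect for a permuted
    [b] says that the permutation preserves them. Zero coefficients are dropped to keep the lists
    short. *)
Definition bracket_defect (b : seq (seq ew_term)) (i j : nat) : seq ew_term :=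
  comb_scale 2 (comb_bracket (nth [::] b i) (nth [::] b j)) ++
  flatten [seq if p.1 == 0 then [::] else comb_scale (- p.1) p.2
          | p <- zip (structure_constants2 i j) b].

Definition S3_words : seq (seq nat) :=
  [:: [:: 0; 1; 2]; [:: 0; 2; 1]; [:: 1; 0; 2]; [:: 1; 2; 0];
      [:: 2; 0; 1]; [:: 2; 1; 0]]%N.

Definition perm_word (s : 'S_3) : seq nat := [seq val (s i) | i <- enum 'I_3].

Lemma perm_word_in s : perm_word s \in S3_words.
Proof.
have : uniq (perm_word s).
  by rewrite map_inj_uniq ?enum_uniq // => i j /val_inj/perm_inj.
rewrite /perm_word ord3E /=.
(* Of the 27 words, 21 have a repetition and contradict uniqueness; the other six are listed. *)
by case: (ord3P (s ord0)) => ->; case: (ord3P (s (lift ord0 ord0))) => ->;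
   case: (ord3P (s ord_max)) => ->.
Qed.

Lemma wf_formal_chevalley :
  all (fun t => (size (formal_chevalley t) == 28)
                && all (all wf_term) (formal_chevalley t)) S3_words.
Proof. by vm_compute. Qed.

(** The finite check over the integers. The identity word also certifies that [coords2] computes the
    right coordinates of these brackets. *)
Lemma bracket_defect_check :
  all (fun t => all (fun i => all (fun j =>
      zero_check (bracket_defect (formal_chevalley t) i j))
    (iota 0 28)) (iota 0 28)) S3_words.
Proof. by vm_compute. Qed.

(** * The formal bases realized in the Lie algebra *)

Lemma comb_pos i j : comb (pos_ew i j) = ew F i j.
Proof. by rewrite /comb big_seq1 scale1r. Qed.

Lemma comb_neg i j : comb (neg_ew i j) = - ew F i j.
Proof. by rewrite /comb big_seq1 scaleN1r. Qed.

Lemma chevalleyE s :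
  chevalley s = map comb (formal_chevalley (perm_word s)).
Proof.
rewrite /chevalley /perm_word ord3E /=.
have HE i : Hout F i = comb (nth [::] formal_Hout i).
  case: (ord3P i) => ->;
    by rewrite /= /comb big_cons big_seq1 ?scale1r ?scaleN1r.
have VE i : [:: V F i ord0; V F i (lift ord0 ord0); V F i ord_max] =
    map comb (nth [::] formal_V i).
  by case: (ord3P i) => ->; rewrite /= ?comb_pos ?comb_neg.
have VdE i : [:: Vd F i ord0; Vd F i (lift ord0 ord0); Vd F i ord_max] =
    map comb (nth [::] formal_Vd i).
  by case: (ord3P i) => ->; rewrite /= ?comb_pos ?comb_neg.
rewrite !HE !cats0 !map_cat -!VE -!VdE /=.
by rewrite -/formal_Ha2 comb_cat !comb_pos comb_neg.
Qed.

Lemma size_chevalley s : size (chevalley s) = 28%N.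
Proof. by rewrite /chevalley ord3E. Qed.

(** * The action on the Chevalley basis *)

(** A coordinate vector of the 3-space is not in the plane of sum zero. Subtracting (1/3, 1/3, 1/3)
    puts it there, where the Weyl action applies; what is left is a third of the sum [S] of the
    outer coroots, which lies in [L] and is fixed. *)
Lemma so8_act_Hout (s : 'S_3) i : so8_act F s (Hout F i) = Hout F (s i).
Proof.
pose third : 'rV[F]_3 := const_mx 3%:R^-1.
pose S := \sum_k Hout F k.
have SE : S = Ha1 F + Ha2 F + Ha3 F + Ha4 F - Ha2 F.
  rewrite /S !big_ord_recl big_ord0 addr0 addrA.
  by rewrite [X in X + _ - _]addrAC [X in X - _]addrAC addrK.
have SL : so8_act F s S = S.
  rewrite SE; apply: so8_act_L; apply: memvB; apply: memv_span.
    exact: (@mem_nth _ 0 (L_basis F) 7).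
  exact: (@mem_nth _ 0 (L_basis F) 6).
have phid j : phi2 (delta_mx 0 j - third) = Hout F j - 3%:R^-1 *: S.
  rewrite /phi2 /S scaler_sumr.
  under eq_bigr do rewrite !mxE scalerBl /=.
  rewrite sumrB (bigD1 j) //= big1 => [|k /negPf kj]; last by rewrite kj scale0r.
  by rewrite eqxx scale1r addr0.
have -> : Hout F i = phi2 (delta_mx 0 i - third) + 3%:R^-1 *: S.
  by rewrite phid subrK.
rewrite linearD linearZ /= SL so8_act_phi2.
  have -> : weyl s (delta_mx 0 i - third) = delta_mx 0 (s i) - third.
    by apply/rowP=> j; rewrite !mxE /= (canF_eq (permKV s)).
  by rewrite phid subrK.
rewrite !big_ord_recl big_ord0 !mxE /=.
have n3 : 3%:R != 0 :> F by rewrite pnatr_eq0.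
by case: (ord3P i) => ->; rewrite /=; field.
Qed.

Lemma so8_act_chevalley s : map (so8_act F s) (chevalley 1) = chevalley s.
Proof.
rewrite /chevalley ord3E /= !perm1 !so8_act_Hout !so8_act_V !so8_act_Vd.
have L k : (k < 8)%N -> so8_act F s (L_basis F)`_k = (L_basis F)`_k.
  by move=> k8; apply: so8_act_L; apply: memv_span; apply: mem_nth.
by rewrite (L 0) // (L 1) // (L 2) // (L 3) // (L 4) // (L 5) // (L 6).
Qed.

Lemma span_chevalley : (fullv <= <<chevalley 1>>)%VS.
Proof.
have LC k : (k < 7)%N -> (L_basis F)`_k \in <<chevalley 1>>%VS.
  move=> k7; apply: memv_span; rewrite (_ : (L_basis F)`_k = (chevalley 1)`_k).
    by rewrite mem_nth ?size_chevalley ?(leq_trans k7).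
  by move: k k7; do 7!case=> //.
have HC i : Hout F i \in <<chevalley 1>>%VS.
  apply: memv_span; rewrite !mem_cat; apply/or4P; apply: Or42.
  by apply/mapP; exists i; rewrite ?mem_enum ?perm1.
apply: subv_trans (span_adapted F) _; apply/span_subvP => x.
rewrite !mem_cat => /or4P[/(nthP 0)[k k8 <-] | /mapP[c _ ->] | xV | xVd].
- have [/LC //|k7] := ltnP k 7.
  (* The only vector of [L_basis] absent from [chevalley 1] is the sum of all four simple
     coroots. *)
  have -> : k = 7%N by apply/eqP; rewrite eqn_leq k7 -ltnS k8.
  exact: memvD (memvD (memvD (HC ord0) (LC 6%N isT)) (HC (lift ord0 ord0)))
    (HC ord_max).
- by apply: memv_suml => i _; apply/memvZ/HC.
- by apply: memv_span; rewrite !mem_cat xV !orbT.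
by apply: memv_span; rewrite !mem_cat xVd !orbT.
Qed.

(** * Compatibility of the action with the bracket *)

Definition lin_comb (c : seq int) (v : seq (so8 F)) : so8 F :=
  \sum_(p <- zip c v) p.1%:~R *: p.2.

Lemma lin_comb_map (f : 'End(so8 F)) c v :
  f (lin_comb c v) = lin_comb c (map f v).
Proof.
rewrite /lin_comb.
elim: c v => [|a c IHc] [|x v]; rewrite ?big_nil ?linear0 //=.
by rewrite !big_cons linearD linearZ /= IHc.
Qed.

Lemma comb_flatten c b :
  comb (flatten [seq if p.1 == 0 then [::] else comb_scale (- p.1) p.2
                | p <- zip c b]) = - lin_comb c (map comb b).
Proof.
rewrite /lin_comb.
elim: c b => [|a c IHc] [|l b]; rewrite ?big_nil ?comb_nil ?oppr0 //=.
rewrite comb_cat IHc big_cons opprD; congr (_ + _) => /=.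
case: eqP => [-> | _]; rewrite ?comb_nil ?scale0r ?oppr0 //.
by rewrite comb_scaleE mulrNz scaleNr.
Qed.

(** The coefficients on the right do not depend on [s]; this is what makes the action preserve
    brackets. *)
Lemma bracket_chevalley s i j : (i < 28)%N -> (j < 28)%N ->
  2%:R *: bracket (chevalley s)`_i (chevalley s)`_j =
    lin_comb (structure_constants2 i j) (chevalley s).
Proof.
move=> i28 j28; have sW := perm_word_in s.
have /allP/(_ _ sW)/andP[/eqP sz /allP wf] := wf_formal_chevalley.
have /allP/(_ _ sW)/allP/(_ i) := bracket_defect_check.
rewrite mem_iota => /(_ i28)/allP/(_ j); rewrite mem_iota => /(_ j28).
move/comb_eq0; rewrite /bracket_defect comb_cat comb_flatten.
rewrite comb_scaleE comb_bracketE ?wf ?mem_nth ?sz // -chevalleyE => /eqP.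
rewrite subr_eq0 => /eqP <-.
by rewrite chevalleyE !(nth_map [::]) ?sz.
Qed.

Lemma so8_act_bracket s x y :
  so8_act F s (bracket x y) = bracket (so8_act F s x) (so8_act F s y).
Proof.
set f := so8_act F s; set B := in_tuple (chevalley 1).
have fB (i : 'I_(size B)) : f B`_i = (chevalley s)`_i.
  by rewrite -[in RHS]so8_act_chevalley (nth_map 0).
have xB z : z = \sum_i coord B i z *: B`_i.
  by apply: coord_span; apply: (subvP span_chevalley); apply: memvf.
have fE z : f z = \sum_i coord B i z *: f B`_i.
  by rewrite [in LHS](xB z) linear_sum; apply: eq_bigr => i _; rewrite linearZ.
rewrite [in LHS](xB x) bracket_suml linear_sum (fE x) bracket_suml.
apply: eq_bigr => i _; rewrite linearZ /=; congr (_ *: _).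
rewrite [in LHS](xB y) (fE y) !linear_sum /=.
apply: eq_bigr => j _; rewrite !linearZ /=; congr (_ *: _).
have n2 : 2%:R != 0 :> F by rewrite pnatr_eq0.
have i28 : (i < 28)%N by rewrite (leq_trans (ltn_ord i)) ?size_chevalley.
have j28 : (j < 28)%N by rewrite (leq_trans (ltn_ord j)) //= ord3E.
(* After doubling, both sides are the same combination of [chevalley s]. *)
apply: (scalerI n2); rewrite -linearZ /= !fB !bracket_chevalley //.
by rewrite lin_comb_map so8_act_chevalley.
Qed.

(** * Group law, injectivity and the effect on the generators *)

Lemma chevalley_ind (P : so8 F -> Prop) :
    (forall a x y, P x -> P y -> P (a *: x + y)) ->
    (forall x, x \in chevalley 1 -> P x) -> forall x, P x.
Proof.
move=> PD PC x; have x1 : x \in <<in_tuple (chevalley 1)>>%VS.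
  exact: (subvP span_chevalley _ (memvf x)).
have P0 : P 0.
  have Xa2P : P (Xa2 F) by apply: PC; apply: mem_head.
  (* Zero is obtained as [- x + x] for a basis vector [x]. *)
  by have := PD (- 1) _ _ Xa2P Xa2P; rewrite scaleN1r addNr.
rewrite (coord_span x1); elim/big_rec: _ => // i y _ Py.
by apply: PD => //; apply/PC/mem_nth.
Qed.

Lemma so8_act1 : so8_act F 1 = \1%VF.
Proof.
apply/lfunP=> x; rewrite id_lfunE; elim/chevalley_ind: x => [a x y xE yE | x].
  by rewrite linearP /= xE yE.
move=> /(nthP 0)[k k28 <-].
by rewrite -[in RHS]so8_act_chevalley (nth_map 0) //.
Qed.

Lemma so8_actM s t : so8_act F (s * t)%g = (so8_act F t \o so8_act F s)%VF.
Proof.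
apply/lfunP=> x; rewrite comp_lfunE; elim/chevalley_ind: x => [a x y xE yE | x].
  by rewrite !linearP /= xE yE.
have L z : z \in L_basis F -> so8_act F (s * t) z = so8_act F t (so8_act F s z).
  by move=> zL; rewrite !so8_act_L ?memv_span.
rewrite !mem_cat => /or4P[xL | /mapP[i _ ->] | | ].
- by apply: L; rewrite (mem_take (n0 := 7)).
- by rewrite !so8_act_Hout permM perm1.
- by case/allpairsP=> [[i k]] /= [_ _ ->]; rewrite !so8_act_V permM perm1.
by case/allpairsP=> [[i k]] /= [_ _ ->]; rewrite !so8_act_Vd permM perm1.
Qed.

(** The outer coroots occur among 28 vectors spanning a space of dimension at least 28; these are
    free, hence distinct. *)
Lemma Hout_inj : injective (Hout F).
Proof.
have U : uniq (chevalley 1).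
  apply: free_uniq; apply: (@basis_free _ _ fullv).
  by rewrite basisEdim span_chevalley size_chevalley dim_so8.
have HE i : Hout F i = (chevalley 1)`_(7 + i).
  by rewrite /chevalley ord3E; case: (ord3P i) => ->; rewrite /= perm1.
have lt28 (i : 'I_3) : (7 + i < size (chevalley 1))%N.
  by rewrite size_chevalley; have := ltn_ord i; lia.
move=> i j; rewrite !HE => /eqP; rewrite nth_uniq ?lt28 // eqn_add2l => /eqP.
exact: val_inj.
Qed.

Lemma so8_act_Xout (s : 'S_3) i : so8_act F s (Xout F i) = Xout F (s i).
Proof.
have XV j : Xout F j = V F j (lift ord0 ord0) by case: (ord3P j) => ->.
by rewrite !XV so8_act_V.
Qed.

Lemma so8_act_Yout s i : so8_act F s (Yout F i) = Yout F (s i).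
Proof.
have YV j : Yout F j = Vd F j (lift ord0 ord0) by case: (ord3P j) => ->.
by rewrite !YV so8_act_Vd.
Qed.

Lemma so8_act_inj : injective (so8_act F).
Proof.
move=> s t st; apply/permP=> i; apply: Hout_inj.
by rewrite -!so8_act_Hout st.
Qed.

Lemma so8_act_lie_aut s : lie_aut (so8_act F s).
Proof.
split=> [|x y]; last exact: so8_act_bracket.
exists (so8_act F s^-1) => x; rewrite -comp_lfunE -so8_actM.
  by rewrite mulgV so8_act1 id_lfunE.
by rewrite mulVg so8_act1 id_lfunE.
Qed.

Lemma so8_act_permutes s : permutes_generators s (so8_act F s).
Proof.
have L k : (k < 8)%N -> so8_act F s (L_basis F)`_k = (L_basis F)`_k.
  by move=> k8; apply: so8_act_L; apply: memv_span; apply: mem_nth.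
split; [exact: (L 0) | exact: (L 1%N) | exact: (L 6%N) | move=> i].
by rewrite so8_act_Xout so8_act_Yout so8_act_Hout.
Qed.

(** * Uniqueness of an automorphism with prescribed values on the generators *)

(** Of the four terms of the derivation rule, only the one pairing [e_j] with [e_k] survives. *)
Lemma bracket_ew_chain i j k l :
    (0 < i <= 8)%N -> (0 < j <= 8)%N -> (0 < l <= 8)%N -> (j + k = 9)%N ->
    (i + k != 9)%N -> (i + l != 9)%N -> (j + l != 9)%N ->
  ew F i l = - bracket (ew F i j) (ew F k l).
Proof.
move=> i8 j8 l8 jk /negPf ik /negPf il /negPf jl.
have k8 : (0 < k <= 8)%N by lia.
have wf p q : (0 < p <= 8)%N -> (0 < q <= 8)%N -> all wf_term (pos_ew p q).
  by move=> /andP[p0 p9] /andP[q0 q9]; rewrite /= /wf_term /= p0 p9 q0 q9.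
rewrite -!comb_pos -comb_bracketE ?wf // /comb_bracket /= jk eqxx ik il jl /=.
by rewrite /comb !big_seq1 /= scaleN1r opprK scale1r.
Qed.

Lemma lie_aut_determined (s : 'S_3) (f g : 'End(so8 F)) :
    lie_aut f -> lie_aut g ->
    permutes_generators s f -> permutes_generators s g ->
  f = g.
Proof.
move=> [_ fB] [_ gB] [fX fY fH fO] [gX gY gH gO].
pose agree i j := f (ew F i j) = g (ew F i j).
have agreeC i j : agree i j -> agree j i.
  by rewrite /agree /ew (wedgeC (e F j)) !linearN /= => ->.
have chain i j k l : agree i j -> agree k l ->
    [&& 0 < i <= 8, 0 < j <= 8, 0 < l <= 8, j + k == 9, i + k != 9, i + l != 9
      & j + l != 9]%N -> agree i l.
  move=> aij akl /and5P[i8 j8 l8 /eqP jk /and3P[ik il jl]].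
  rewrite /agree (@bracket_ew_chain i j k l) // !linearN /=.
  by rewrite fB gB aij akl.
have outX i : f (Xout F i) = g (Xout F i).
  by have [-> _ _] := fO i; have [-> _ _] := gO i.
have outY i : f (Yout F i) = g (Yout F i).
  by have [_ -> _] := fO i; have [_ -> _] := gO i.
have outH i : f (Hout F i) = g (Hout F i).
  by have [_ _ ->] := fO i; have [_ _ ->] := gO i.
have a17 : agree 1 7 := outX ord0.
have a26 : agree 2 6 := etrans fX (esym gX).
have a35 : agree 3 5 := outX (lift ord0 ord0).
have a34 : agree 3 4 := outX ord_max.
have a28 : agree 2 8 := outY ord0.
have a37 : agree 3 7 := etrans fY (esym gY).
have a46 : agree 4 6 := outY (lift ord0 ord0).
have a56 : agree 5 6 := outY ord_max.
(* From the eight simple root vectors above, each of the other sixteen is reached as a bracket of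
   two already treated; [agreeC] brings the dual indices to the middle. *)
have a16 : agree 1 6 := chain 1 7 2 6 a17 a26 isT.
have a25 : agree 2 5 := chain 2 6 3 5 a26 a35 isT.
have a24 : agree 2 4 := chain 2 6 3 4 a26 a34 isT.
have a15 : agree 1 5 := chain 1 7 2 5 a17 a25 isT.
have a14 : agree 1 4 := chain 1 7 2 4 a17 a24 isT.
have a23 : agree 2 3 := chain 2 5 4 3 a25 (agreeC _ _ a34) isT.
have a13 : agree 1 3 := chain 1 5 4 3 a15 (agreeC _ _ a34) isT.
have a12 : agree 1 2 := chain 1 6 3 2 a16 (agreeC _ _ a23) isT.
have a38 : agree 3 8 := chain 3 7 2 8 a37 a28 isT.
have a47 : agree 4 7 := chain 4 6 3 7 a46 a37 isT.
have a57 : agree 5 7 := chain 5 6 3 7 a56 a37 isT.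
have a48 : agree 4 8 := chain 4 7 2 8 a47 a28 isT.
have a58 : agree 5 8 := chain 5 7 2 8 a57 a28 isT.
have a67 : agree 6 7 := chain 6 4 5 7 (agreeC _ _ a46) a57 isT.
have a68 : agree 6 8 := chain 6 7 2 8 a67 a28 isT.
have a78 : agree 7 8 := chain 7 6 3 8 (agreeC _ _ a67) a38 isT.
have aN i j : agree i j -> f (- ew F i j) = g (- ew F i j).
  by rewrite !linearN /= => ->.
have agreeV i k : f (V F i k) = g (V F i k).
  case: (ord3P i) => ->; case: (ord3P k) => ->;
    [exact: aN a16 | exact: a17 | exact: a67 | exact: a25 | exact: a35
    | exact: a58 | exact: a24 | exact: a34 | exact: a48].
have agreeVd i k : f (Vd F i k) = g (Vd F i k).
  case: (ord3P i) => ->; case: (ord3P k) => ->;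
    [exact: a23 | exact: a28 | exact: aN a38 | exact: a14 | exact: a46
    | exact: a47 | exact: a15 | exact: a56 | exact: a57].
apply/lfunP=> x; elim/chevalley_ind: x => [a x y xE yE | x].
  by rewrite !linearP /= xE yE.
rewrite !mem_cat => /or4P[ | /mapP[i _ ->] | | ].
- case/(nthP 0)=> k + <-; do 7?[case: k => [_|k] //=];
    by rewrite ?fX ?gX ?fY ?gY ?fH ?gH.
- exact: outH.
- by case/allpairsP=> [[i k]] /= [_ _ ->].
by case/allpairsP=> [[i k]] /= [_ _ ->].
Qed.

Lemma so8_act_embedding : S3_embedding_in_Aut (so8_act F).
Proof.
split; [exact: so8_act_lie_aut | exact: so8_act1 | exact: so8_actM |].
exact: so8_act_inj.
Qed.

(** One direction gives uniqueness of the triality action, the other its existence. *)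
Lemma triality_actionP (tau : 'S_3 -> 'End(so8 F)) :
  triality_action tau <-> tau =1 so8_act F.
Proof.
split=> [tauP s | tauE s].
  have [tauL tauG] := tauP s.
  exact: lie_aut_determined tauL (so8_act_lie_aut s) tauG (so8_act_permutes s).
by rewrite tauE; split; [exact: so8_act_lie_aut | exact: so8_act_permutes].
Qed.

End Triality.

Theorem theorem4p1 (R : realType) :
  S3_embedding_in_Aut (so8_act R[i]) /\
  (forall tau : 'S_3 -> 'End(so8 R[i]),
      triality_action tau <-> tau =1 so8_act R[i]).
Proof. split; [exact: so8_act_embedding | exact: triality_actionP]. Qed.
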